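(* Let $L,H>0$, $x_0\in(0,L)$, $p\in[1,\infty]$, $\gamma>0$. Let $g\in\mathrm{BV}((0,L))$ be given by $g(x)=0$ for $x<x_0$ and $g(x)=H$ for $x>x_0$. For $\lambda\ge0$ let $$F(u)=\mathrm{TV}_{\phi,\theta}(u;(0,L))+\lambda\|u-g\|_p^\gamma .$$ For $\alpha\ge\alpha^*:=\frac{H}{2\min\{x_0,L-x_0\}}$, define the competitor $u_\alpha\in\mathrm{BV}((0,L))$ as $$u_\alpha(x)=\min\left\{\max\left\{\tfrac H2+\alpha(x-x_0),\,0\right\},\,H\right\}.$$ (i) If $\theta(H)=H$ and $$\inf_{\alpha\ge\alpha^*}\frac{\phi(\alpha)-\alpha}{\alpha^{1-\gamma/p}}=-\infty,$$ then for every $\lambda\ge0$ there exists $\alpha\ge\alpha^*$ such that $F(u_\alpha)<F(g)$; hence the input $g$ is not optimal. (ii) If instead either $\theta(H)<H$, or $\theta(H)=H$ and $$\inf_{\alpha\ge\alpha^*}\frac{\phi(\alpha)-\alpha}{\alpha^{1-\gamma/p}}>-\infty,$$ then for every $\lambda\ge0$ sufficiently large we have $F(u_\alpha)\ge F(g)$ for all $\alpha\ge\alpha^*$; hence the input $g$ performs better than these particular competitors.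
   Context: Throughout, $\phi,\theta:[0,\infty)\to[0,\infty)$ are non-decreasing, $\phi$ is convex, $\theta$ is concave, $\phi(0)=\theta(0)=0$ and $\lim_{t\to\infty}\phi(t)/t=\lim_{t\to0^+}\theta(t)/t=1$. For a function $u$ of bounded variation on an open interval $I$, with derivative decomposed as $Du=u'\mathcal{L}^1+D^cu+D^ju$ (absolutely continuous, Cantor and jump parts), jump set $J_u$ and jumps $[u](x)=u^+(x)-u^-(x)$ (difference of right and left limits), the nonlinear total variation is $$\mathrm{TV}_{\phi,\theta}(u;I)=\int_I\phi(|u'(x)|)\,dx+|D^cu|(I)+\sum_{x\in J_u}\theta(|[u](x)|).$$ $\|\cdot\|_p$ is the $L^p$ norm on $(0,L)$; for $p=\infty$, $\gamma/p$ is interpreted as $0$. *)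

(* Defs.v *)
From HB Require Import structures.
From mathcomp Require Import all_boot all_order all_algebra.
From mathcomp Require Import all_classical all_reals all_analysis.

Set Implicit Arguments.
Unset Strict Implicit.
Unset Printing Implicit Defensive.

Import Order.TTheory GRing.Theory Num.Theory.
Import numFieldNormedType.Exports.

Local Open Scope classical_set_scope.
Local Open Scope ring_scope.

Section charges.
Context d (T : measurableType d) (R : realType).
Implicit Types nu : {charge set T -> \bar R}.

Lemma hahn_witness nu :
  {PN : set T * set T | hahn_decomposition nu PN.1 PN.2}.
Proof.
by apply: cid; have [P [N PN]] := Hahn_decomposition nu; exists (P, N).
Qed.

(* |nu|(A), for A measurable; it does not depend on the Hahn decomposition. *)
Definition charge_abs nu : set T -> \bar R :=
  charge_variation (projT2 (hahn_witness nu)).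

Definition charge_integral nu (D : set T) (f : T -> \bar R) : \bar R :=
  (\int[jordan_pos (projT2 (hahn_witness nu))]_(x in D) f x
   - \int[jordan_neg (projT2 (hahn_witness nu))]_(x in D) f x)%E.

End charges.

Section bounded_variation.
Context {R : realType}.
Implicit Types (I : set R) (u f h phi theta : R -> R) (x : R).

Local Notation mu := (@lebesgue_measure R).

(* Test functions of class C^1_c(I). *)
Definition C1c I h : Prop :=
  [/\ forall x, derivable h x 1,
      continuous (derive1 h),
      compact (closure [set x | h x != 0]) &
      closure [set x | h x != 0] `<=` I].

Definition distributional_derivative I u (Du : {charge set (measurableTypeR R) -> \bar R}) : Prop :=
  forall h, C1c I h ->
    (\int[mu]_(x in I) (u x * derive1 h x)%:E
     = - charge_integral Du I (EFin \o h))%E.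

(* u is in BV(I), for I open: u is in L^1(I) and its distributional derivative
   is a finite signed measure on I. The values of u (and of Du) outside of I
   are irrelevant here and below. *)
Definition BV I u : Prop :=
  mu.-integrable I (EFin \o u) /\
  exists Du, distributional_derivative I u Du.

(* One-sided limits are taken up to null sets, so that they only depend on the
   a.e. class of u. *)
Definition ess_at_right x : set_system R :=
  [set A | exists2 e : R, 0 < e & {ae mu, forall y, x < y < x + e -> A y}].

Definition ess_at_left x : set_system R :=
  [set A | exists2 e : R, 0 < e & {ae mu, forall y, x - e < y < x -> A y}].

Definition right_lim u x : R := lim (u @ ess_at_right x).
Definition left_lim u x : R := lim (u @ ess_at_left x).

Definition jump u x : R := right_lim u x - left_lim u x.

Definition jump_set I u : set R :=
  [set x | [/\ I x, cvg (u @ ess_at_right x), cvg (u @ ess_at_left x) &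
               jump u x != 0]].

Record derivative_parts := DerivativeParts {
  ac_density : R -> R ;
  cantor_part : {charge set (measurableTypeR R) -> \bar R} ;
  jump_part : {charge set (measurableTypeR R) -> \bar R} }.

(* Du = u' L^1 + D^c u + D^j u on I, where D^c u is singular and has no atom,
   and D^j u is concentrated on J_u, with mass [u](x) at x. For u in BV(I)
   this determines u' a.e. in I, and D^c u and D^j u on the Borel subsets
   of I. *)
Record derivative_decomposition I u (D : derivative_parts) : Prop := {
  integrable_ac_density : mu.-integrable I (EFin \o ac_density D) ;
  cantor_part_singular : exists N : set (measurableTypeR R),
    [/\ measurable N, mu N = 0%E &
        forall A : set (measurableTypeR R), measurable A -> A `<=` I `\` N ->
          cantor_part D A = 0%E] ;
  cantor_part_no_atom : forall x, I x -> cantor_part D [set x] = 0%E ;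
  jump_part_concentrated :
    forall A : set (measurableTypeR R), measurable A ->
      A `<=` I `\` jump_set I u -> jump_part D A = 0%E ;
  jump_part_atom : forall x, jump_set I u x ->
    jump_part D [set x] = (jump u x)%:E ;
  derivative_eq_sum_parts : exists2 Du, distributional_derivative I u Du &
    forall A : set (measurableTypeR R), measurable A -> A `<=` I ->
      Du A = (\int[mu]_(x in A) (ac_density D x)%:E
              + cantor_part D A + jump_part D A)%E }.

(* The (essentially unique) decomposition of the derivative of u in BV(I);
   an irrelevant default value is returned if there is none. *)
Definition derivative I u : derivative_parts :=
  xget (T := {classic derivative_parts}) (DerivativeParts (cst 0) czero czero)
    [set D | derivative_decomposition I u D].

(* Meaningful for u in BV(I) only. *)
Definition nonlinear_TV phi theta I u : \bar R :=
  (\int[mu]_(x in I) (phi `|ac_density (derivative I u) x|)%:E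
   + charge_abs (cantor_part (derivative I u)) I
   + \esum_(x in jump_set I u) (theta `|jump u x|)%:E)%E.

(* As phi and theta are functions on [0, +oo[, nothing is required from their
   values at negative reals. *)
Record TV_integrands phi theta : Prop := {
  phi_ge0 : {in `[0, +oo[, forall t, 0 <= phi t} ;
  theta_ge0 : {in `[0, +oo[, forall t, 0 <= theta t} ;
  phi_nondecreasing : {in `[0, +oo[ &, {homo phi : s t / s <= t}} ;
  theta_nondecreasing : {in `[0, +oo[ &, {homo theta : s t / s <= t}} ;
  phi_convex : convex_function (`[0, +oo[%classic : set R^o) phi ;
  theta_concave : convex_function (`[0, +oo[%classic : set R^o) (\- theta) ;
  phi0 : phi 0 = 0 ;
  theta0 : theta 0 = 0 ;
  phi_slope : phi t / t @[t --> +oo] --> (1 : R) ;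
  theta_slope : theta t / t @[t --> 0^'+] --> (1 : R) }.

Definition denoising_functional phi theta I (g : R -> R) (p : \bar R)
    (gamma lambda : R) u : \bar R :=
  (nonlinear_TV phi theta I u
   + lambda%:E * 'N[mu]_p[EFin \o ((u \- g)%R \_ I)] `^ gamma)%E.

Definition ramp (x0 H alpha : R) : R -> R :=
  fun x => Num.min (Num.max (H / 2 + alpha * (x - x0)) 0) H.

(* gamma / p, with gamma / +oo = 0 *)
Definition div_exponent (gamma : R) (p : \bar R) : R :=
  if p is r%:E then gamma / r else 0.

Definition slope_quotient phi (gamma : R) (p : \bar R) (alpha : R) : R :=
  (phi alpha - alpha) / alpha `^ (1 - div_exponent gamma p).

End bounded_variation.

(* Main.v *)
(* The values F(g) = theta(H) and
   F(u_alpha) = phi(alpha) H / alpha + lambda ||u_alpha - g||_p^gamma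
   have to be extracted from the decomposition of the distributional derivative,
   which is only specified up to null sets. Testing against C^1 functions that
   converge to the indicator of an interval shows that the derivative is
   determined on the Borel subsets of I. Removing the null set that carries the
   Cantor part then identifies the density almost everywhere, whence the Cantor
   part vanishes for g and u_alpha, whose derivatives are H delta_(x0) and
   alpha 1_J with J the interval of length H / alpha centred at x0.
   Since |u_alpha - g| <= H/2 on J, vanishes outside J, and is >= H/4 on an
   interval of length H / (4 alpha), ||u_alpha - g||_p^gamma lies between
   constant multiples of alpha^(-gamma/p). As
   phi(alpha) / alpha - 1 = slope_quotient(alpha) alpha^(-gamma/p),
   the sign of F(u_alpha) - F(g) is governed by the infimum of the quotient when
   theta(H) = H. When theta(H) < H, the limit phi(alpha) / alpha -> 1 settles
   large alpha, and a large lambda settles the bounded ones. *)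
Require Import Defs.
From HB Require Import structures.
From mathcomp Require Import all_boot all_order all_algebra.
From mathcomp Require Import all_classical all_reals all_analysis.
From mathcomp Require Import measurable_realfun ess_sup_inf.
From mathcomp Require Import ring lra.

Set Implicit Arguments.
Unset Strict Implicit.
Unset Printing Implicit Defensive.

Import Order.TTheory GRing.Theory Num.Theory.
Import numFieldNormedType.Exports.

Local Open Scope classical_set_scope.
Local Open Scope ring_scope.

(** * Test functions approximating the indicator of an open interval *)

Section test_functions.
Context {R : realType}.
Implicit Types a b e t x y : R.

(** The first-order error is at most [h ^+ 2], by comparing the signs of [y] and [h + y]; hence the
    difference quotient is within |h| of the limit. *)
Lemma is_derive_sqr_max0 y :
  is_derive y 1 (fun t => Num.max t 0 ^+ 2) (2 * Num.max y 0).
Proof.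
suff cv : h^-1 *: (Num.max (h *: 1 + y) 0 ^+ 2 - Num.max y 0 ^+ 2)
    @[h --> 0^'] --> 2 * Num.max y 0.
  by split; [apply/cvg_ex; exists (2 * Num.max y 0)|exact: cvg_lim cv].
apply/cvgrPdist_le => e e0; near=> h.
have h0 : h != 0 by near: h; exact: nbhs_dnbhs_neq.
have he : `|h| <= e by near: h; exact: dnbhs0_le.
apply: le_trans he.
rewrite [h *: 1]mulr1 [_ *: _]mulrC.
(* Multiplying by [h] clears the division and leaves a polynomial inequality in each sign case. *)
have : (Num.max (h + y) 0 ^+ 2 - Num.max y 0 ^+ 2) - 2 * Num.max y 0 * h
       = h * ((Num.max (h + y) 0 ^+ 2 - Num.max y 0 ^+ 2) / h - 2 * Num.max y 0).
  by field.
have hh : 0 < `|h| by rewrite normr_gt0.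
rewrite -(ler_pM2l hh) distrC -normrM => <-.
rewrite -normrM -expr2 (ger0_norm (sqr_ge0 h)).
rewrite ler_norml; have [hy|hy] := leP (h + y) 0; have [y0|y0] := leP y 0;
  apply/andP; split; nra.
Unshelve. all: by end_near. Qed.

Lemma continuous_max0 : continuous (fun t : R => Num.max t 0).
Proof.
by move=> x; apply: (@continuous_max _ _ id (cst 0));
  [exact: cvg_id|exact: cst_continuous].
Qed.

(* It vanishes where (x - a) (b - x) <= e, so that its support is compact in
   ]a, b[, and it is C^1 because t |-> max(t, 0)^2 is. *)
Definition bump a b e x : R :=
  1 - e / (Num.max ((x - a) * (b - x) - e) 0 ^+ 2 + e).

Lemma bump_den_gt0 a b e x : 0 < e ->
  0 < Num.max ((x - a) * (b - x) - e) 0 ^+ 2 + e.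
Proof. by move=> e0; rewrite ltr_wpDl ?sqr_ge0. Qed.

Lemma bump_ge0 a b e x : 0 < e -> 0 <= bump a b e x.
Proof.
move=> e0; rewrite subr_ge0 ler_pdivrMr ?bump_den_gt0// mul1r.
by rewrite lerDr sqr_ge0.
Qed.

Lemma bump_le1 a b e x : 0 < e -> bump a b e x <= 1.
Proof.
by move=> e0; rewrite gerBl divr_ge0 ?ltW// ltr_wpDl ?sqr_ge0.
Qed.

Lemma bump_neq0 a b e x : 0 < e -> bump a b e x != 0 -> e < (x - a) * (b - x).
Proof.
move=> e0; apply: contraNT; rewrite -leNgt -subr_le0 => qe.
by rewrite /bump max_r// expr0n add0r divff ?subrr// gt_eqF.
Qed.

(** A positive product [(x - a) * (b - x)] forces both factors to be positive: both negative would
    give [b < x < a]. *)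
Lemma bump_eq0 a b e x : a < b -> 0 < e -> ~ (a < x < b) -> bump a b e x = 0.
Proof.
move=> ab e0 axb; apply/eqP/negP => /negP /(bump_neq0 e0) exq; apply: axb.
have q0 := lt_trans e0 exq.
by apply/andP; split; rewrite ltNge; apply/negP => ?; nra.
Qed.


(** Outside the interval the sequence is constantly zero; inside, [(x - a) * (b - x)] is positive,
    so the denominator has a positive limit while the numerator tends to zero. *)
Lemma cvg_bump a b x : a < b ->
  bump a b n.+1%:R^-1 x @[n --> \oo] --> (\1_`]a, b[ x : R).
Proof.
move=> ab; rewrite indicE; have [axb|axb] := boolP (x \in `]a, b[); last first.
  rewrite memNset; last by move=> /= h; rewrite h in axb.
  apply: cvg_near_cst; apply: nearW => n /=.
  by rewrite bump_eq0 ?invr_gt0// => h; rewrite in_itv/= h in axb.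
rewrite mem_set//= -[1%:R]subr0.
have q0 : 0 < (x - a) * (b - x).
  by move: axb; rewrite in_itv/= => /andP[ax xb]; rewrite mulr_gt0 ?subr_gt0.
apply: cvgB; first exact: cvg_cst.
have e0 : n.+1%:R^-1 @[n --> \oo] --> (0 : R) by exact: cvg_harmonic.
rewrite -[X in _ --> X](mul0r ((Num.max ((x - a) * (b - x)) 0 ^+ 2 + 0)^-1)).
apply: cvgM => //; apply: cvgV.
  by rewrite addr0 expf_neq0// max_l ?gt_eqF ?ltW.
apply: cvgD => //.
under eq_fun do rewrite expr2.
rewrite expr2.
have h : Num.max ((x - a) * (b - x) - n.+1%:R^-1) 0 @[n --> \oo] -->
   Num.max ((x - a) * (b - x)) 0.
  apply: (continuous_cvg _ (@continuous_max0 _)).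
  rewrite -[X in _ --> X]subr0; apply: cvgB => //; exact: cvg_cst.
apply: (cvgM h h).
Qed.

(** The derivative given by the quotient and chain rules; [a + b - 2 * x] is the derivative of
    [(x - a) * (b - x)]. *)
Let dbump a b e x : R :=
  e * (2 * Num.max ((x - a) * (b - x) - e) 0 * (a + b - 2 * x)) /
  (Num.max ((x - a) * (b - x) - e) 0 ^+ 2 + e) ^+ 2.

Lemma is_derive_bump a b e x : 0 < e ->
  is_derive x 1 (bump a b e) (dbump a b e x).
Proof.
move=> e0.
pose q x := (x - a) * (b - x) - e.
have dq : is_derive x 1 q (a + b - 2 * x).
  apply: is_derive_eq; rewrite /GRing.scale/=; ring.
have ds := is_derive1_comp (is_derive_sqr_max0 (q x)) dq.
have den0 : (Num.max (q x) 0 ^+ 2 + e) != 0 by rewrite gt_eqF// bump_den_gt0.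
have dsd : is_derive x 1 (fun x => Num.max (q x) 0 ^+ 2 + e)
    (2 * Num.max (q x) 0 * (a + b - 2 * x)).
  have h := is_deriveD ds (is_derive_cst e x 1).
  by rewrite addr0 in h; exact: h.
have dV := @is_deriveV _ (fun x => Num.max (q x) 0 ^+ 2 + e) _ _ _ den0 dsd.
have h := is_deriveB (is_derive_cst (1:R) x 1) (is_deriveZ e dV).
apply: (@is_derive_eq _ _ _ _ _ _ _ _ h).
rewrite /dbump /GRing.scale/= -/(q x) ; field.
by [].
Qed.

(** The support lies in the closed set [e <= (x - a) * (b - x)], which is contained in []a, b[]
    because [e] is positive; it is compact as a closed subset of a segment. *)
Lemma C1c_bump (I : set R) a b e : a < b -> `]a, b[%classic `<=` I -> 0 < e ->
  C1c I (bump a b e).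
Proof.
move=> ab abI e0.
have cK : closed [set x : R | e <= (x - a) * (b - x)].
  have cf : continuous (fun x : R => (x - a) * (b - x)).
    move=> x; apply: (@continuousM _ _ (fun x => x - a) (fun x => b - x));
      apply: continuousB => //; (exact: cvg_id || exact: cst_continuous).
  rewrite (_ : [set _ | _] = (fun x : R => (x - a) * (b - x)) @^-1` [set y | e <= y])//.
  by apply: closed_comp => // x _; exact: cf.
have SK : closure [set x | bump a b e x != 0] `<=` [set x | e <= (x - a) * (b - x)].
  rewrite [X in _ `<=` X](closure_id _).1//; apply: closure_subset => x /=.
  by move=> /(bump_neq0 e0)/ltW.
have Kab : [set x : R | e <= (x - a) * (b - x)] `<=` `]a, b[.
  move=> x/= ex; rewrite in_itv/=.
  by apply/andP; split; rewrite ltNge; apply/negP => ?; nra.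
split.
- by move=> x; have [] := is_derive_bump a b x e0.
- have -> : derive1 (bump a b e) = dbump a b e.
    by apply/funext => x; rewrite derive1E; have [_ ->] := is_derive_bump a b x e0.
  have cm : continuous (fun x : R => Num.max ((x - a) * (b - x) - e) 0).
    move=> x; apply: (continuous_cvg _ (@continuous_max0 _)).
      apply: (@continuousB _ _ _ (fun x => (x - a) * (b - x)) (fun=> e));
      last exact: cst_continuous.
      apply: (@continuousM _ _ (fun x => x - a) (fun x => b - x));
      apply: continuousB => //; (exact: cvg_id || exact: cst_continuous).
  move=> x; rewrite /dbump; apply: cvgM.
    apply: cvgM; first exact: cvg_cst.
    apply: cvgM; first by apply: cvgM; [exact: cvg_cst|exact: cm].
    apply: cvgB; first exact: cvg_cst.
    by apply: cvgM; [exact: cvg_cst|exact: cvg_id].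
  apply: cvgV; first by rewrite expf_neq0 ?gt_eqF ?bump_den_gt0.
  have cd : Num.max ((y - a) * (b - y) - e) 0 ^+ 2 + e @[y --> x] -->
      Num.max ((x - a) * (b - x) - e) 0 ^+ 2 + e.
    by apply: cvgD; [rewrite expr2; under eq_fun do rewrite expr2;
       apply: cvgM; exact: cm|exact: cvg_cst].
  rewrite expr2; under eq_fun do rewrite expr2; exact: (cvgM cd cd).
- apply: (@subclosed_compact _ _ `[a, b]); first exact: closed_closure.
  + exact: segment_compact.
  + by move=> x /SK /Kab; exact: subset_itv_oo_cc.
- by move=> x /SK /Kab /abI.
Qed.

End test_functions.

(** * Finite measures on an interval are determined by test functions *)

Section measures_determined_by_test_functions.
Context {R : realType}.
Implicit Types (a b c d : R) (m : {measure set (measurableTypeR R) -> \bar R}).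

Lemma C1c_measurable (I : set R) (h : R -> R) :
  C1c I h -> measurable_fun (setT : set (measurableTypeR R)) h.
Proof.
move=> [dh _ _ _]; apply: continuous_measurable_fun => x.
exact/differentiable_continuous/derivable1_diffP/dh.
Qed.

(** Dominated convergence: the bumps are bounded by 1, which is integrable because [m I] is
    finite. *)
Lemma cvg_integral_bump m (I : set R) a b :
    measurable (I : set (measurableTypeR R)) -> (m I < +oo)%E ->
    a < b -> `]a, b[%classic `<=` I ->
  (\int[m]_(x in I) (bump a b n.+1%:R^-1 x)%:E @[n --> \oo] -->
   m `]a, b[%classic)%E.
Proof.
move=> mI mIoo ab abI.
have e0 n : 0 < n.+1%:R^-1 :> R by rewrite invr_gt0.
have <- : (\int[m]_(x in I) (\1_`]a, b[ x)%:E = m `]a, b[%classic)%E.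
  by rewrite integral_indic//; congr (m _); exact: setIidl.
apply: (@dominated_cvg _ _ _ _ _ mI _ _ (cst 1%E)) => //.
- move=> n; apply/measurable_EFinP; apply: measurable_funTS.
  exact: (C1c_measurable (C1c_bump ab abI (e0 n))).
- by move=> x Ix; apply: cvg_EFin; [exact: nearW|exact: cvg_bump].
- apply: measurable_bounded_integrable => //.
  by exists 1; split => // M M1 x _ /=; rewrite normr1 ltW.
- by move=> n x Ix; rewrite /= lee_fin ger0_norm ?bump_ge0// bump_le1.
Qed.

(** Bumps give equality on open subintervals. The two measures restricted to [I] then agree on the
    half-lines []x, +oo[], a generating family stable under intersection, hence on all Borel
    sets. *)
Lemma measure_eq_C1c m1 m2 c d : let I : set R := `]c, d[%classic in
    (m1 I < +oo)%E -> (m2 I < +oo)%E ->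
    (forall h, C1c I h ->
      \int[m1]_(x in I) (h x)%:E = \int[m2]_(x in I) (h x)%:E)%E ->
  forall A : set (measurableTypeR R), measurable A -> A `<=` I -> m1 A = m2 A.
Proof.
move=> I m1I m2I m12 A mA AI.
have mI : measurable (I : set (measurableTypeR R)) by exact: measurable_itv.
have itv a b : `]a, b[%classic `<=` I -> m1 `]a, b[%classic = m2 `]a, b[%classic.
  move=> abI; have [ab|ba] := ltP a b; last first.
    by rewrite set_itv_ge ?measure0// bnd_simp -leNgt.
  have c1 := @cvg_integral_bump m1 I a b mI m1I ab abI.
  have c2 := @cvg_integral_bump m2 I a b mI m2I ab abI.
  have e12 : (fun n : nat => \int[m1]_(x in I) (bump a b n.+1%:R^-1 x)%:E)%E =
             (fun n => \int[m2]_(x in I) (bump a b n.+1%:R^-1 x)%:E)%E.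
    by apply/funext => n; apply: m12; apply: C1c_bump; rewrite ?invr_gt0.
  by rewrite e12 in c1; exact: cvg_unique c1 c2.
suff : mrestr m1 mI A = mrestr m2 mI A.
  by rewrite /mrestr (setIidl AI).
apply: (@measure_unique _ R (measurableTypeR R) (@RGenOInfty.G R)
  (fun n => `](- n%:R), +oo[%classic) _ _ _ _ (mrestr m1 mI) (mrestr m2 mI)) => //.
- exact: RGenOInfty.measurableE.
- move=> _ _ [x ->] [y ->]; exists (Num.max x y).
  by apply/seteqP; split => z/=; rewrite !in_itv/= !andbT gt_max => /andP.
- by move=> n; exists (- n%:R).
- rewrite -subTset -(bigcup_itvT false false); apply: subset_bigcup => n _ x/=.
  by rewrite !in_itv/= => /andP[->].
- move=> _ [x ->]; rewrite /mrestr /=.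
  (* The trace of a half-line on [I] is again an open interval, possibly empty, to which [itv]
     applies. *)
  have xI : `]x, +oo[ `&` I = `](Num.max x c), d[%classic.
    apply/seteqP; split => z; rewrite /I/= !in_itv/= gt_max andbT.
      by move=> [-> /andP[-> ->]].
    by move=> /andP[/andP[-> ->] ->].
  have := itv (Num.max x c) d; rewrite -xI; apply.
  exact: subIsetr.
- move=> n; apply: le_lt_trans m1I => /=.
  apply: le_measure; rewrite ?inE//.
  by apply: measurableI => //.
Qed.

End measures_determined_by_test_functions.

(** * Integration against a nonnegative charge *)

Section charge_integral_measure.
Context d (T : measurableType d) (R : realType).
Local Open Scope ereal_scope.

(** A negative set of a nonnegative charge has only null subsets, so whatever Hahn decomposition was
    picked, the positive Jordan part is [m] and the negative one is zero. *)
Lemma charge_integral_measure (nu : {charge set T -> \bar R})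
    (m : {measure set T -> \bar R}) (D : set T) (f : T -> \bar R) :
    (forall A, measurable A -> nu A = m A) ->
  charge_integral nu D f = \int[m]_(x in D) f x.
Proof.
move=> num; rewrite /charge_integral; case: hahn_witness => -[P N] PN /=.
have [[mP _] [mN nuN] PNT PN0] := PN.
have nuN0 A : measurable A -> nu (A `&` N) = 0.
  move=> mA; have mAN : measurable (A `&` N) by exact: measurableI.
  by apply/eqP; rewrite eq_le nuN//= num.
rewrite (eq_measure_integral m); last first.
  move=> A mA _ /=; rewrite jordan_posE/= /crestr0 mem_set//=.
  by rewrite -num// (charge_partition nu mA mP mN PNT PN0) nuN0// adde0.
rewrite [X in _ - X](eq_measure_integral mzero); last first.
  move=> A mA _ /=; rewrite jordan_negE cjordan_negE /crestr0 mem_set//=.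
  by rewrite /crestr/= nuN0// oppe0.
by rewrite integral_measure_zero sube0.
Qed.

End charge_integral_measure.

(** * Uniqueness of the distributional derivative *)

Section derivative_uniqueness.
Context {R : realType}.
Implicit Types (c d y : R) (u f : R -> R).
Local Notation mu := (@lebesgue_measure R).

Lemma C1c_bounded (I : set R) (h : R -> R) : C1c I h ->
  exists M, forall x, `|h x| <= M.
Proof.
move=> [dh _ ch _].
have cth : continuous h.
  by move=> x; exact/differentiable_continuous/derivable1_diffP/dh.
have /compact_bounded [M [_ hM]] :=
  continuous_compact (continuous_subspaceT cth) ch.
(* The bound from compactness holds for every number strictly above [M]; |M| + 1 is one of them and
   is also nonnegative, as the zeros of [h] require. *)
exists (`|M| + 1) => x; have [->|hx] := eqVneq (h x) 0.
  by rewrite normr0 addr_ge0.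
apply: (hM (`|M| + 1)); first by rewrite (le_lt_trans (ler_norm M))// ltrDl.
by exists x => //; apply: subset_closure.
Qed.

Lemma C1c_integrable (m : {measure set (measurableTypeR R) -> \bar R})
    (I D : set R) h : measurable (D : set (measurableTypeR R)) ->
  (m D < +oo)%E -> C1c I h -> m.-integrable D (EFin \o h).
Proof.
move=> mD mDoo hI; apply: measurable_bounded_integrable => //.
  by apply: measurable_funTS; exact: (C1c_measurable hI).
have [M hM] := C1c_bounded hI.
by exists M; split => [|N MN x _]; rewrite ?num_real//; exact: le_trans (hM x) (ltW MN).
Qed.

(** Moves the negative parts across, so that an identity between signed measures becomes one between
    sums of positive measures. *)
Lemma sube_eq_sube (a b a' b' : \bar R) : a \is a fin_num -> b \is a fin_num ->
  a' \is a fin_num -> b' \is a fin_num ->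
  (a - b = a' - b' <-> a + b' = a' + b)%E.
Proof.
move: a b a' b' => [a| |]// [b| |]// [a'| |]// [b'| |]// _ _ _ _.
by rewrite -!EFinN -!EFinD; split => -[abab]; congr EFin; lra.
Qed.

(** With Jordan parts [p1], [n1] and [p2], [n2], the hypotheses say that [p1 + n2] and [p2 + n1]
    integrate every test function alike; these are finite positive measures, which test functions
    determine. *)
Lemma distributional_derivative_unique c d u
    (nu1 nu2 : {charge set (measurableTypeR R) -> \bar R}) :
    let I : set R := `]c, d[%classic in
    distributional_derivative I u nu1 -> distributional_derivative I u nu2 ->
  forall A : set (measurableTypeR R), measurable A -> A `<=` I -> nu1 A = nu2 A.
Proof.
move=> I u1 u2 A mA AI.
have mI : measurable (I : set (measurableTypeR R)) by exact: measurable_itv.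
move: u1 u2; rewrite /distributional_derivative /charge_integral.
set W1 := svalP (hahn_witness nu1); set W2 := svalP (hahn_witness nu2).
rewrite (jordan_decomp W1 mA) (jordan_decomp W2 mA) /cadd/= !cscaleN1.
set p1 := jordan_pos W1; set n1 := jordan_neg W1.
set p2 := jordan_pos W2; set n2 := jordan_neg W2 => u1 u2.
have fin (m : {finite_measure set (measurableTypeR R) -> \bar R}) B :
    measurable B -> (m B < +oo)%E.
  by move=> mB; rewrite -ge0_fin_numE// fin_num_measure.
have finA (m : {finite_measure set (measurableTypeR R) -> \bar R}) :
    m A \is a fin_num by exact: fin_num_measure.
apply/(sube_eq_sube (finA p1) (finA n1) (finA p2) (finA n2)).
rewrite -2!measure_addE; apply: (@measure_eq_C1c _ _ _ c d _ _ _ A mA AI).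
- by rewrite [X in (X < _)%E]measure_addE lte_add_pinfty ?fin.
- by rewrite [X in (X < _)%E]measure_addE lte_add_pinfty ?fin.
move=> h hI; have hint (m : {finite_measure set (measurableTypeR R) -> \bar R}) :
    m.-integrable I (EFin \o h) by apply: (C1c_integrable mI) hI; exact: fin.
have hfin (m : {finite_measure set (measurableTypeR R) -> \bar R}) :
    (\int[m]_(x in I) (h x)%:E)%E \is a fin_num.
  exact: (integrable_fin_num mI (hint m)).
rewrite !(integral_measure_add mI (hint _) (hint _)).
apply/(sube_eq_sube (hfin p1) (hfin n1) (hfin p2) (hfin n2)).
by apply: oppe_inj; rewrite -(u1 h hI) -(u2 h hI).
Qed.

(** * Uniqueness of the parts of the derivative when there is at most one jump point *)

Section decomposition.
Variables (c d y : R) (u : R -> R).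
Let I : set R := `]c, d[%classic.
Hypothesis Ju : jump_set I u `<=` [set y].

(** Off [y] both parts vanish because the set misses the jump set; at [y] the mass is the prescribed
    jump or, when [y] is no jump point, zero. *)
Lemma jump_part_unique D1 D2 : derivative_decomposition I u D1 ->
    derivative_decomposition I u D2 ->
  forall A : set (measurableTypeR R), measurable A -> A `<=` I ->
    jump_part D1 A = jump_part D2 A.
Proof.
move=> [_ _ _ c1 a1 _] [_ _ _ c2 a2 _] A mA AI.
have my : measurable ([set y] : set (measurableTypeR R)) by exact: measurable_set1.
rewrite -(setDUK (@subIsetl _ A [set y])) !chargeU; try by
  [exact: measurableI|apply: measurableD => //; exact: measurableI|rewrite setDIK].
have AyJ : A `\` (A `&` [set y]) `<=` I `\` jump_set I u.
  move=> x [Ax Axy]; split; first exact: AI.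
  by move=> /Ju xy; exact: Axy.
have mAy : measurable (A `\` (A `&` [set y]) : set (measurableTypeR R)).
  by apply: measurableD => //; exact: measurableI.
rewrite (c1 _ mAy AyJ) (c2 _ mAy AyJ); congr (_ + _)%E.
have [Ay|Ay] := pselect (A y); last first.
  rewrite (_ : A `&` [set y] = set0) ?charge0// -subset0 => x [Ax /= xy].
  by apply: Ay; rewrite -xy.
rewrite (_ : A `&` [set y] = [set y]); last first.
  by apply/seteqP; split => [x []//|x /= ->].
have [Jy|Jy] := pselect (jump_set I u y); first by rewrite a1// a2.
by rewrite c1 ?c2// => x /= ->; split=> //; exact: AI.
Qed.

(** Both decompositions have the same total derivative and the same jump part. Cancelling the latter
    leaves an identity between densities and Cantor parts; once the densities have equal integrals,
    the Cantor part is zero. *)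
Lemma derivative_decomposition_ae f j D :
    derivative_decomposition I u (DerivativeParts f czero j) ->
    derivative_decomposition I u D ->
  ae_eq mu I (EFin \o ac_density D) (EFin \o f) /\
  forall A : set (measurableTypeR R), measurable A -> A `<=` I ->
    cantor_part D A = 0%E.
Proof.
move=> Df DD; have jE := jump_part_unique Df DD.
case: Df DD => [/= intf _ _ _ _ [nu1 d1 e1]] [intD [N [mN N0 cN]] _ _ _ [nu2 d2 e2]].
have mI : measurable (I : set (measurableTypeR R)) by exact: measurable_itv.
have eq12 A : measurable (A : set (measurableTypeR R)) -> A `<=` I ->
    (\int[mu]_(x in A) (ac_density D x)%:E + cantor_part D A =
     \int[mu]_(x in A) (f x)%:E)%E.
  move=> mA AI; have := distributional_derivative_unique d1 d2 mA AI.
  rewrite e1// e2// jE//= adde0.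
  have jfin : jump_part D A \is a fin_num by exact: fin_num_measure.
  by move=> /(congr1 (fun t => t - jump_part D A)%E); rewrite !addeK// => <-.
have intSI A g : measurable (A : set (measurableTypeR R)) -> A `<=` I ->
    mu.-integrable I g -> mu.-integrable A g.
  by move=> mA AI; exact: integrableS.
(* N carries the Cantor part, so it can be discarded from the integrals. *)
have eqint A : A `<=` I -> measurable (A : set (measurableTypeR R)) ->
    (\int[mu]_(x in A) (ac_density D x)%:E = \int[mu]_(x in A) (f x)%:E)%E.
  move=> AI mA.
  have mAN : measurable (A `\` N : set (measurableTypeR R)) by exact: measurableD.
  have ANI : A `\` N `<=` I by move=> x [/AI].
  rewrite (negligible_integral mN)//; last exact: intSI.
  rewrite [RHS](negligible_integral mN)//; last exact: intSI.
  by rewrite -eq12// cN ?adde0// => x [/AI].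
split.
  apply: integral_ae_eq => //; exact: measurable_int intf.
move=> A mA AI; have := eq12 A mA AI; rewrite eqint//.
have : (\int[mu]_(x in A) (f x)%:E)%E \is a fin_num.
  by apply: integrable_fin_num => //; exact: intSI.
have : cantor_part D A \is a fin_num by exact: fin_num_measure.
move: (cantor_part D A) (\int[mu]_(x in A) (f x)%:E)%E => [r| |]// [s| |]// _ _.
by rewrite -EFinD => -[rs]; congr EFin; lra.
Qed.

(** [derivative] makes an arbitrary choice, but all choices share the density almost everywhere and
    have zero Cantor part on [I], so any explicit decomposition without Cantor part computes the
    functional. *)
Lemma nonlinear_TV_eq phi theta f j : TV_integrands phi theta ->
    derivative_decomposition I u (DerivativeParts f czero j) ->
  nonlinear_TV phi theta I u =
  (\int[mu]_(x in I) (phi `|f x|)%:E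
   + \esum_(x in jump_set I u) (theta `|jump u x|)%:E)%E.
Proof.
move=> pt Df.
(* A decomposition exists, so [xget] does not return its default value. *)
have DD : derivative_decomposition I u (derivative I u).
  by apply: (@xgetPex {classic _} _ [set D | derivative_decomposition I u D]);
    exists (DerivativeParts f czero j).
have [aef c0] := derivative_decomposition_ae Df DD.
have mI : measurable (I : set (measurableTypeR R)) by exact: measurable_itv.
rewrite /nonlinear_TV; congr (_ + _)%E.
have mphi g : mu.-integrable I (EFin \o g) ->
    measurable_fun I (fun x => (phi `|g x|)%:E).
  move=> /measurable_int/measurable_EFinP mg; apply/measurable_EFinP.
  (* [phi] is known to be monotone only on nonnegative reals; precomposing with the maximum with
     zero gives a function monotone on the whole line, hence measurable. *)
  rewrite (_ : (fun x => phi `|g x|) = (fun t => phi (Num.max t 0)) \o (fun x => `|g x|)).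
    have mpos : measurable_fun [set: R] (fun t => phi (Num.max t 0)).
      apply: nondecreasing_measurable => // s t st.
      apply: (phi_nondecreasing pt); rewrite ?in_itv/= ?andbT ?le_max ?lexx ?orbT//.
      rewrite !ge_max st lexx andbT/=; have [//|t0] := leP 0 t.
      by rewrite (le_trans st (ltW t0)).
    apply: (measurableT_comp mpos); exact: measurableT_comp.
  by apply/funext => x /=; rewrite max_l.
(* The variation is computed from the values on the intersections of [I] with [P] and [N], where the
   Cantor part vanishes. *)
have -> : charge_abs (cantor_part (derivative I u)) I = 0%E.
  rewrite /charge_abs; case: hahn_witness => -[P N] PN /=.
  have [[mP _] [mN _] _ _] := PN.
  rewrite /charge_variation jordan_posE jordan_negE cjordan_negE/= /crestr0 mem_set//.
  by rewrite /crestr !c0 ?oppe0 ?adde0//; [exact: measurableI|exact: measurableI].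
rewrite adde0; apply: ge0_ae_eq_integral => //.
- by apply: mphi; case: DD.
- by apply: mphi; case: Df.
- by move=> x _; rewrite lee_fin (phi_ge0 pt)// in_itv/= normr_ge0.
- by move=> x _; rewrite lee_fin (phi_ge0 pt)// in_itv/= normr_ge0.
- by apply: filterS aef => x /= h Ix; have [->] := h Ix.
Qed.

End decomposition.

End derivative_uniqueness.

(** * Essential one-sided limits and jumps *)

Section essential_limits.
Context {R : realType}.
Implicit Types (x l : R) (u f : R -> R).
Local Notation mu := (@lebesgue_measure R).

(** A null set would have to contain []a, b[], of length [b - a > 0]. This is what makes the
    essential one-sided filters proper. *)
Lemma itv_not_negligible (a b : R) : a < b ->
  ~ {ae mu, forall y, ~ (a < y < b)}.
Proof.
move=> ab [N [mN N0 abN]].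
have : (mu `]a, b[%classic <= mu N)%E.
  apply: le_measure; rewrite ?inE//.
  by move=> y /=; rewrite in_itv/= => yab; apply: abN => /= h; exact: h yab.
by rewrite N0 lebesgue_measure_itv/= lte_fin ab -EFinB lee_fin leNgt subr_gt0 ab.
Qed.

Lemma ess_at_right_filter x : ProperFilter (ess_at_right x).
Proof.
split.
  by move=> [e e0 h]; apply: (@itv_not_negligible x (x + e)); rewrite ?ltrDl.
split.
- by exists 1 => //; exact: nearW.
- move=> A B [e e0 hA] [d d0 hB]; exists (Num.min e d); first by rewrite lt_min e0.
  have FF := ae_filter_ringOfSetsType mu.
  apply: (@filterS _ _ FF _ _ _ (@filterI _ _ FF _ _ hA hB)) => y.
  move=> [{}hA {}hB] /andP[xy ye]; split.
    by apply: hA; rewrite xy (lt_le_trans ye)// lerD2l ge_min lexx.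
  by apply: hB; rewrite xy (lt_le_trans ye)// lerD2l ge_min lexx orbT.
- move=> A B AB [e e0 hA]; exists e => //.
  have FF := ae_filter_ringOfSetsType mu.
  by apply: (@filterS _ _ FF _ _ _ hA) => y {}hA /hA/AB.
Qed.

Lemma ess_at_left_filter x : ProperFilter (ess_at_left x).
Proof.
split.
  by move=> [e e0 h]; apply: (@itv_not_negligible (x - e) x); rewrite ?ltrBlDr ?ltrDl.
split.
- by exists 1 => //; exact: nearW.
- move=> A B [e e0 hA] [d d0 hB]; exists (Num.min e d); first by rewrite lt_min e0.
  have FF := ae_filter_ringOfSetsType mu.
  apply: (@filterS _ _ FF _ _ _ (@filterI _ _ FF _ _ hA hB)) => y.
  move=> [{}hA {}hB] /andP[ye yx]; split.
    by apply: hA; rewrite yx andbT (le_lt_trans _ ye)// lerD2l lerN2 ge_min lexx.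
  by apply: hB; rewrite yx andbT (le_lt_trans _ ye)// lerD2l lerN2 ge_min lexx orbT.
- move=> A B AB [e e0 hA]; exists e => //.
  have FF := ae_filter_ringOfSetsType mu.
  by apply: (@filterS _ _ FF _ _ _ hA) => y {}hA /hA/AB.
Qed.

Local Hint Extern 0 (ProperFilter (ess_at_right _)) =>
  exact: ess_at_right_filter : typeclass_instances.
Local Hint Extern 0 (ProperFilter (ess_at_left _)) =>
  exact: ess_at_left_filter : typeclass_instances.

(** Each one-sided neighbourhood is also an essential one, so the essential filter is finer and
    inherits ordinary limits. *)
Lemma ess_at_right_cvg u x l : u y @[y --> x^'+] --> l ->
  u @ ess_at_right x --> l.
Proof.
move=> ul; apply: cvg_trans ul; apply: cvg_app => A [e /= e0 h].
by exists e => //; apply: nearW => y /andP[xy ye]; apply: h => //=;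
  rewrite distrC ger0_norm ?subr_ge0 ?ltW// ltrBlDl.
Qed.

Lemma ess_at_left_cvg u x l : u y @[y --> x^'-] --> l ->
  u @ ess_at_left x --> l.
Proof.
move=> ul; apply: cvg_trans ul; apply: cvg_app => A [e /= e0 h].
by exists e => //; apply: nearW => y /andP[xy ye]; apply: h => //=;
  rewrite ger0_norm ?subr_ge0 ?ltW// ltrBlDr -ltrBlDl.
Qed.

Lemma right_limE u x l : u y @[y --> x^'+] --> l -> right_lim u x = l.
Proof. by move=> /ess_at_right_cvg; exact: cvg_lim. Qed.

Lemma left_limE u x l : u y @[y --> x^'-] --> l -> left_lim u x = l.
Proof. by move=> /ess_at_left_cvg; exact: cvg_lim. Qed.

Lemma jump_set_discontinuous (I : set R) u x : {for x, continuous u} ->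
  ~ jump_set I u x.
Proof.
move=> cu [_ _ _]; rewrite /jump (@right_limE _ _ (u x)) ?(@left_limE _ _ (u x)).
- by rewrite subrr eqxx.
- exact: cvg_at_left_filter.
- exact: cvg_at_right_filter.
Qed.

End essential_limits.

(** * Integration by parts on subintervals *)

Section integrals_against_test_functions.
Context {R : realType}.
Implicit Types (a b c x y : R) (h : R -> R).
Local Notation mu := (@lebesgue_measure R).

Lemma integral_itv_cat a b c (f : R -> \bar R) : a <= b -> b <= c ->
    measurable_fun `]a, c[ f ->
  (\int[mu]_(x in `]a, c[) f x =
   \int[mu]_(x in `]a, b[) f x + \int[mu]_(x in `]b, c[) f x)%E.
Proof.
move=> ab bc mf.
(* Cutting at [b] loses only the point [b], which is Lebesgue-null. *)
have acE : `]a, c[%classic `\ b = `]a, b[%classic `|` `]b, c[%classic.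
  apply/seteqP; split => x /=; rewrite !in_itv/=.
    by move=> [/andP[-> ->] /eqP]; rewrite neq_lt => /orP[->|->]; [left|right].
  case=> /andP[ax xb]; split; rewrite ?ax ?xb ?(lt_le_trans xb)//.
  - by apply/eqP; rewrite lt_eqF.
  - by rewrite (le_lt_trans ab).
  - by apply/eqP; rewrite gt_eqF.
have mac : measurable (`]a, c[%classic `\ b) by exact: measurableD.
have mf' : measurable_fun (`]a, c[%classic `\ b) f.
  by apply: measurable_funS mf => // x [].
rewrite -(integral_setD1 mac mf') acE integral_setU//; first by rewrite -acE.
apply/disj_set2P/seteqP; split => // x [/=].
by rewrite !in_itv/= => /andP[_ xb] /andP[/(lt_trans xb)]; rewrite ltxx.
Qed.

Lemma lebesgue_itv_lty (a b : R) : (mu `]a, b[%classic < +oo)%E.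
Proof. by rewrite lebesgue_measure_itv/=; case: ifPn => _; rewrite ?ltry. Qed.

Lemma C1c_cvg (I : set R) h x : C1c I h -> h y @[y --> x] --> h x.
Proof.
by move=> [dh _ _ _]; exact/differentiable_continuous/derivable1_diffP/dh.
Qed.

Lemma C1c_derivable_oo (I : set R) h a b : C1c I h ->
  derivable_oo_LRcontinuous h a b.
Proof.
move=> hI; split; first by move=> x _; case: hI.
- by apply: cvg_at_right_filter; apply: C1c_cvg hI.
- by apply: cvg_at_left_filter; apply: C1c_cvg hI.
Qed.

Lemma C1c_derive1_continuous (I D : set R) h : C1c I h ->
  {within D, continuous (derive1 h)}.
Proof. by move=> [_ ch _ _]; exact: continuous_subspaceT. Qed.

Lemma C1c_derive1_measurable (I D : set R) h : C1c I h ->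
  measurable_fun D (derive1 h).
Proof.
by move=> [_ ch _ _]; apply: measurable_funTS; exact: continuous_measurable_fun.
Qed.

Lemma continuous_itv_integrable (f : R -> R) a b : continuous f ->
  mu.-integrable `]a, b[ (EFin \o f).
Proof.
move=> cf; apply: (@integrableS _ _ _ mu `[a, b]%classic) => //.
- exact: subset_itv_oo_cc.
- apply: continuous_compact_integrable; first exact: segment_compact.
  exact: continuous_subspaceT.
Qed.

Lemma integral_derive1_C1c (I : set R) h a b : C1c I h -> a <= b ->
  (\int[mu]_(x in `]a, b[) (derive1 h x)%:E = (h b - h a)%:E)%E.
Proof.
move=> hI; rewrite le_eqVlt => /predU1P[->|ab].
  by rewrite set_itv_ge ?bnd_simp ?ltxx// integral_set0 subrr.
have mh : measurable_fun `]a, b[ (EFin \o derive1 h).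
  by apply/measurable_EFinP; exact: C1c_derive1_measurable hI.
rewrite -(@integral_itv_bndoo _ a b _ true false mh).
rewrite (@continuous_FTC2 _ (derive1 h) h)//.
- exact: C1c_derive1_continuous hI.
- exact: C1c_derivable_oo hI.
Qed.

(** Integration by parts: the weight [x - a] vanishes at [a], so only the boundary term at [b]
    remains. *)
Lemma integral_affine_derive1_C1c (I : set R) h a b : C1c I h -> a <= b ->
  (\int[mu]_(x in `]a, b[) ((x - a) * derive1 h x)%:E =
   ((b - a) * h b)%:E - \int[mu]_(x in `]a, b[) (h x)%:E)%E.
Proof.
move=> hI; rewrite le_eqVlt => /predU1P[->|ab].
  by rewrite set_itv_ge ?bnd_simp ?ltxx// !integral_set0 subrr mul0r sube0.
have mh : measurable_fun `]a, b[ (EFin \o (fun x => (x - a) * derive1 h x)).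
  apply/measurable_EFinP/measurable_funM.
    by apply: measurable_funB.
  exact: C1c_derive1_measurable hI.
have mh2 : measurable_fun `]a, b[ (EFin \o h).
  by apply/measurable_EFinP; apply: measurable_funTS; exact: (C1c_measurable hI).
rewrite -(@integral_itv_bndoo _ a b _ true false mh).
rewrite -(@integral_itv_bndoo _ a b _ true false mh2).
rewrite (@integration_by_parts _ (fun x => x - a) h (cst 1) (derive1 h))//.
- rewrite subrr mul0r subr0; congr (_ - _)%E.
  by apply: eq_integral => x _; rewrite mul1r.
- by apply: continuous_subspaceT => x; exact: cst_continuous.
- split.
  + by move=> x _; exact: derivableB.
  + by apply: cvg_at_right_filter; apply: cvgB => //; exact: cvg_cst.
  + by apply: cvg_at_left_filter; apply: cvgB => //; exact: cvg_cst.
- move=> x _; rewrite derive1E deriveB// derive_id derive_cst subr0//.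
- exact: C1c_derive1_continuous hI.
- exact: C1c_derivable_oo hI.
Qed.

Lemma C1c_eq0 (I : set R) h x : C1c I h -> ~ I x -> h x = 0.
Proof.
move=> [_ _ _ hI] Ix; apply/eqP/negP => /negP hx.
by apply/Ix/hI/subset_closure.
Qed.

End integrals_against_test_functions.

(** * Integration against a scaled measure *)

Section charge_integral_cscale.
Context d (T : measurableType d) (R : realType).
Local Open Scope ereal_scope.

Lemma integral_mscale (k : {nonneg R}) (m : {measure set T -> \bar R})
    (D : set T) (f : T -> \bar R) : measurable D -> m.-integrable D f ->
  \int[mscale k m]_(x in D) f x = k%:num%:E * \int[m]_(x in D) f x.
Proof.
move=> mD intf; have mf := measurable_int _ intf.
rewrite [LHS]integralE [in RHS]integralE.
rewrite !ge0_integral_mscale//; [|exact: measurable_funeneg|exact: measurable_funepos].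
rewrite (@muleBr _ _ (\int[m]_(x in D) f^\+ x) (\int[m]_(x in D) f^\- x))//.
by apply: fin_num_adde_defl; rewrite fin_numN integrable_neg_fin_num.
Qed.

(** For [k >= 0] the scaled charge is a positive measure, so its charge integral is an ordinary
    integral. *)
Lemma charge_integral_cscale (k : R) (m : {finite_measure set T -> \bar R})
    (D : set T) (f : T -> \bar R) :
  (0 <= k)%R -> measurable D -> m.-integrable D f ->
  charge_integral (cscale k (charge_of_finite_measure m)) D f =
  k%:E * \int[m]_(x in D) f x.
Proof.
move=> k0 mD intf; rewrite (@charge_integral_measure _ _ _ _ (mscale (NngNum k0) m))//.
by rewrite integral_mscale.
Qed.

End charge_integral_cscale.

(** * The input: derivative and total variation of the step *)

Section step_function.
Context {R : realType}.
Variables (L H x0 : R) (g : R -> R).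
Hypotheses (H_gt0 : 0 < H) (x0_in : 0 < x0 < L).
Hypothesis g_left : forall x, 0 < x < x0 -> g x = 0.
Hypothesis g_right : forall x, x0 < x < L -> g x = H.
Let I : set R := `]0, L[%classic.
Local Notation mu := (@lebesgue_measure R).

(** The value of [g] at [x0] is unspecified, so [x0] is split off as a measurable singleton; [g] is
    constant on each of the two remaining intervals. *)
Lemma step_measurable : measurable_fun I g.
Proof.
have I0 : I `\ x0 = `]0, x0[%classic `|` `]x0, L[%classic.
  apply/seteqP; split => x; rewrite /I/= !in_itv/=.
    by move=> [/andP[-> ->] /eqP]; rewrite neq_lt => /orP[->|->]; [left|right].
  have /andP[x00 x0L] := x0_in.
  case=> /andP[ax xb]; split; rewrite ?ax ?xb ?(lt_trans xb)//.
  - by apply/eqP; rewrite lt_eqF.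
  - by rewrite (lt_trans x00).
  - by apply/eqP; rewrite gt_eqF.
have Ix0 : I x0 by rewrite /I/= in_itv.
have mU a b : measurable (`]a, b[%classic : set (measurableTypeR R)).
  exact: measurable_itv.
have mI0 : measurable (I `\ x0 : set (measurableTypeR R)).
  by rewrite I0; exact: measurableU.
rewrite -(setD1K Ix0); apply/(measurable_funU _ (measurable_set1 x0) mI0).
split; first exact: measurable_fun_set1.
rewrite I0; apply/(measurable_funU _ (mU _ _) (mU _ _)); split.
- apply: (@eq_measurable_fun _ _ _ R _ (fun=> 0 : R)); last exact: measurable_cst.
  by move=> x; rewrite inE/= in_itv/= => xx; rewrite g_left.
- apply: (@eq_measurable_fun _ _ _ R _ (fun=> H : R)); last exact: measurable_cst.
  by move=> x; rewrite inE/= in_itv/= => xx; rewrite g_right.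
Qed.

Lemma step_integrable : mu.-integrable I (EFin \o g).
Proof.
apply: measurable_bounded_integrable.
- exact: measurable_itv.
- exact: lebesgue_itv_lty.
- exact: step_measurable.
exists (Num.max H `|g x0|); split; first exact: num_real.
move=> M; rewrite gt_max => /andP[HM gM] x; rewrite /I/= in_itv/= => /andP[x_0 xL].
have [xx0|xx0|->] := ltgtP x x0; last exact: ltW.
  by rewrite g_left ?x_0// normr0 ltW// (lt_trans H_gt0).
by rewrite g_right ?xx0// gtr0_norm// ltW.
Qed.

Let step_jump_part : {charge set (measurableTypeR R) -> \bar R} :=
  cscale H (charge_of_finite_measure (\d_(x0 : measurableTypeR R))).

(** Only the integral over []x0, L[] survives; it equals [H * (h L - h x0)], and [h L = 0] since [L]
    lies outside [I]. *)
Lemma step_distributional_derivative :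
  distributional_derivative I g step_jump_part.
Proof.
move=> h hI.
have /andP[x00 x0L] := x0_in.
have mI : measurable (I : set (measurableTypeR R)) by exact: measurable_itv.
have mh : measurable_fun (setT : set (measurableTypeR R)) h := C1c_measurable hI.
rewrite /step_jump_part (charge_integral_cscale (ltW H_gt0) mI); last first.
  by apply: (C1c_integrable mI) hI; rewrite -ge0_fin_numE// fin_num_measure.
rewrite integral_dirac//; last exact/measurable_EFinP/measurable_funTS.
rewrite diracE mem_set ?mul1e; last by rewrite /I/= in_itv.
have mdh D : measurable_fun D (derive1 h) by exact: C1c_derive1_measurable hI.
rewrite (@integral_itv_cat _ 0 x0 L) ?ltW//; last first.
  by apply/measurable_EFinP/measurable_funM => //; exact: step_measurable.
rewrite [X in (X + _)%E]integral0_eq ?add0e; last first.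
  move=> x; rewrite /= in_itv/= => xx.
  by rewrite g_left// mul0r.
transitivity (\int[mu]_(x in `]x0, L[) (H%:E * (derive1 h x)%:E))%E.
  by apply: eq_integral => x; rewrite inE/= in_itv/= => xx; rewrite g_right.
rewrite integralZl//; last first.
  by apply: continuous_itv_integrable; case: hI.
rewrite (integral_derive1_C1c hI) ?ltW//.
rewrite (C1c_eq0 hI (x:=L)) ?sub0r -?EFinM ?mulrN ?EFinN//.
by rewrite /I/= in_itv/= ltxx andbF.
Qed.

Lemma step_right_cvg : g y @[y --> x0^'+] --> H.
Proof.
apply: cvg_near_cst; near=> y; apply: g_right; apply/andP; split.
  by near: y; exact: nbhs_right_gt.
by near: y; apply: nbhs_right_lt; case/andP : x0_in.
Unshelve. all: by end_near. Qed.

Lemma step_left_cvg : g y @[y --> x0^'-] --> 0.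
Proof.
apply: cvg_near_cst; near=> y; apply: g_left; apply/andP; split.
  by near: y; apply: nbhs_left_gt; case/andP : x0_in.
by near: y; exact: nbhs_left_lt.
Unshelve. all: by end_near. Qed.

Lemma step_jump : jump g x0 = H.
Proof.
by rewrite /jump (right_limE step_right_cvg) (left_limE step_left_cvg) subr0.
Qed.

(** Away from [x0] the step is locally constant, hence continuous, and has no jump. *)
Lemma step_jump_set : jump_set I g = [set x0].
Proof.
apply/seteqP; split => [x [Ix rx lx jx]|_ ->]; last first.
  split.
  - by rewrite /I/= in_itv.
  - by apply/cvg_ex; exists H; exact/ess_at_right_cvg/step_right_cvg.
  - by apply/cvg_ex; exists 0; exact/ess_at_left_cvg/step_left_cvg.
  - by rewrite step_jump gt_eqF.
have J : jump_set I g x by [].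
apply: contrapT => /eqP xx0; apply: jump_set_discontinuous J.
move: Ix; rewrite /I/= in_itv/= => /andP[x_gt0 xL].
apply: cvg_near_cst; move: xx0; rewrite neq_lt => /orP[xx0|xx0].
  have gx : g x = 0 by rewrite g_left ?x_gt0.
  near=> y; rewrite gx g_left//; apply/andP; split.
    by near: y; exact: lt_nbhsr.
  by near: y; exact: lt_nbhsl.
have gx : g x = H by rewrite g_right ?xx0.
near=> y; rewrite gx g_right//; apply/andP; split.
  by near: y; exact: lt_nbhsr.
by near: y; exact: lt_nbhsl.
Unshelve. all: by end_near. Qed.

Lemma step_BV : BV I g.
Proof.
split; first exact: step_integrable.
by exists step_jump_part; exact: step_distributional_derivative.
Qed.

Lemma step_decomposition :
  derivative_decomposition I g (DerivativeParts (cst 0) czero step_jump_part).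
Proof.
split => /=.
- exact: integrable0.
- exists set0; split => //; exact: measure0.
- by [].
- move=> A mA; rewrite step_jump_set => AI; rewrite /cscale /=.
  rewrite /charge_of_finite_measure diracE memNset ?mule0// => /AI [_].
  exact.
- move=> x; rewrite step_jump_set => ->; rewrite step_jump /cscale /=.
  by rewrite /charge_of_finite_measure diracE mem_set ?mule1.
- exists step_jump_part; first exact: step_distributional_derivative.
  by move=> A mA AI; rewrite integral0 !add0e.
Qed.

Lemma step_nonlinear_TV phi theta : TV_integrands phi theta ->
  nonlinear_TV phi theta I g = (theta H)%:E.
Proof.
move=> pt.
have J : jump_set I g `<=` [set x0] by rewrite step_jump_set.
rewrite (nonlinear_TV_eq J pt step_decomposition).
rewrite integral0_eq ?add0e; last by move=> x _; rewrite normr0 (phi0 pt).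
rewrite step_jump_set esum_set1 ?step_jump ?gtr0_norm//.
by rewrite lee_fin (theta_ge0 pt)// in_itv/= andbT ltW.
Qed.

End step_function.

(** * The competitors: derivative and total variation of the ramp *)

Section ramp.
Context {R : realType}.
(* k is the half-width of the interval on which the ramp is not constant. *)
Variables (L H x0 alpha k : R).
Hypotheses (H_gt0 : 0 < H) (alpha_gt0 : 0 < alpha) (alphak : alpha * k = H / 2).
Hypotheses (k_le : k <= x0) (k_ge : x0 + k <= L).
Let I : set R := `]0, L[%classic.
Let J : set R := `]x0 - k, x0 + k[%classic.
Local Notation u := (ramp x0 H alpha).
Local Notation mu := (@lebesgue_measure R).

Let k_gt0 : 0 < k.
Proof. by rewrite -(pmulr_rgt0 _ alpha_gt0) alphak divr_gt0. Qed.

Lemma ramp_le x : x <= x0 - k -> u x = 0.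
Proof.
move=> xk; have ak := alphak.
have : 0 <= alpha * (x0 - k - x) by rewrite mulr_ge0 ?subr_ge0// ltW.
by move=> h; rewrite /ramp max_r ?min_l ?(ltW H_gt0)//; lra.
Qed.

Lemma ramp_ge x : x0 + k <= x -> u x = H.
Proof.
move=> xk; have ak := alphak.
have : 0 <= alpha * (x - (x0 + k)) by rewrite mulr_ge0 ?subr_ge0// ltW.
by move=> h; rewrite /ramp min_r// le_max; apply/orP; left; lra.
Qed.

(** Since [alpha * k = H / 2], the affine function runs from 0 to [H] over this interval, and
    neither truncation is active. *)
Lemma ramp_mid x : x0 - k <= x <= x0 + k -> u x = alpha * (x - (x0 - k)).
Proof.
move=> /andP[xk kx]; have ak := alphak; have a0 := alpha_gt0.
have E : H / 2 + alpha * (x - x0) = alpha * (x - (x0 - k)) by rewrite -ak; ring.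
rewrite /ramp E max_l; last by rewrite mulr_ge0 ?subr_ge0// ltW.
rewrite min_l//.
have : 0 <= alpha * (x0 + k - x) by rewrite mulr_ge0 ?subr_ge0// ltW.
by lra.
Qed.

Lemma ramp_continuous : continuous u.
Proof.
move=> x; apply: (@continuous_min _ _ (fun x => Num.max (H / 2 + alpha * (x - x0)) 0) (cst H));
  last exact: cst_continuous.
apply: (@continuous_max _ _ (fun x => H / 2 + alpha * (x - x0)) (cst 0));
  last exact: cst_continuous.
apply: cvgD; first exact: cvg_cst.
by apply: cvgM; [exact: cvg_cst|apply: cvgB; [exact: cvg_id|exact: cvg_cst]].
Qed.

Lemma ramp_ge0 x : 0 <= u x.
Proof. by rewrite /ramp le_min le_max lexx orbT ltW. Qed.

Lemma ramp_le_height x : u x <= H.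
Proof. by rewrite /ramp ge_min lexx orbT. Qed.

Let mI : measurable (I : set (measurableTypeR R)).
Proof. exact: measurable_itv. Qed.

Let mJ : measurable (J : set (measurableTypeR R)).
Proof. exact: measurable_itv. Qed.

Let muJ : (mu J < +oo)%E. Proof. exact: lebesgue_itv_lty. Qed.

Lemma ramp_support_sub : J `<=` I.
Proof.
move=> x; rewrite /J /I/= !in_itv/= => /andP[kx xk].
by rewrite (le_lt_trans _ kx) ?subr_ge0// (lt_le_trans xk).
Qed.

Lemma ramp_measurable (D : set R) : measurable_fun D u.
Proof.
by apply: measurable_funTS; apply: continuous_measurable_fun; exact: ramp_continuous.
Qed.

Lemma ramp_integrable : mu.-integrable I (EFin \o u).
Proof.
apply: measurable_bounded_integrable => //.
- exact: lebesgue_itv_lty.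
- exact: ramp_measurable.
exists H; split; first exact: num_real.
move=> M HM x _ /=; rewrite ger0_norm ?ramp_ge0//.
by rewrite (le_trans (ramp_le_height x))// ltW.
Qed.

Let ramp_charge : {charge set (measurableTypeR R) -> \bar R} :=
  cscale alpha (charge_of_finite_measure (mfrestr mJ muJ)).

(** The restricted measure gives no mass to the complement of [J] and agrees with Lebesgue measure
    on subsets of [J]. *)
Lemma integral_mfrestr (h : R -> R) : C1c I h ->
  (\int[mfrestr mJ muJ]_(x in I) (h x)%:E = \int[mu]_(x in J) (h x)%:E)%E.
Proof.
move=> hI.
have mIJ : measurable (I `\` J : set (measurableTypeR R)) by exact: measurableD.
rewrite (negligible_integral mIJ)//; last 2 first.
- by apply: (C1c_integrable mI) hI; rewrite -ge0_fin_numE// fin_num_measure.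
- by change (mu ((I `\` J) `&` J) = 0%E); rewrite setIC setDIK measure0.
rewrite setDD setIC setIidl; last exact: ramp_support_sub.
apply: eq_measure_integral => A mA AJ.
by change (mu (A `&` J) = mu A); rewrite setIidl.
Qed.

(** Cut at the ends of [J]: the left piece is zero, the right one follows from the fundamental
    theorem of calculus with [h L = 0], and the middle one is integrated by parts. The boundary
    terms at [x0 + k] cancel because [2 * alpha * k = H]. *)
Lemma ramp_distributional_derivative :
  distributional_derivative I u ramp_charge.
Proof.
move=> h hI.
have k0 : 0 <= x0 - k by rewrite subr_ge0.
have kk : x0 - k <= x0 + k by have := k_gt0; lra.
have kL : x0 - k <= L by rewrite (le_trans kk).
rewrite /ramp_charge (charge_integral_cscale (ltW alpha_gt0) mI); last first.
  by apply: (C1c_integrable mI) hI; rewrite -ge0_fin_numE// fin_num_measure.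
rewrite integral_mfrestr//.
have muh D : measurable_fun D (fun x => (u x * derive1 h x)%:E).
  apply/measurable_EFinP/measurable_funM; first exact: ramp_measurable.
  exact: C1c_derive1_measurable hI.
rewrite (integral_itv_cat k0 kL (muh _)) (integral_itv_cat kk k_ge (muh _)).
rewrite [X in (X + _)%E]integral0_eq ?add0e; last first.
  by move=> x; rewrite /= in_itv/= => /andP[_ xk]; rewrite ramp_le ?mul0r// ltW.
have -> : (\int[mu]_(x in `](x0 + k)%R, L[) (u x * derive1 h x)%:E =
    (- (H * h (x0 + k)))%:E)%E.
  transitivity (\int[mu]_(x in `](x0 + k)%R, L[) (H%:E * (derive1 h x)%:E))%E.
    apply: eq_integral => x; rewrite inE/= in_itv/= => /andP[xk _].
    by rewrite ramp_ge// ltW.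
  rewrite integralZl//; last first.
    by apply: continuous_itv_integrable; case: hI.
  rewrite (integral_derive1_C1c hI)// (C1c_eq0 hI (x:=L)) ?sub0r -?EFinM ?mulrN//.
  by rewrite /I/= in_itv/= ltxx andbF.
transitivity (\int[mu]_(x in J) (alpha%:E * ((x - (x0 - k)) * derive1 h x)%:E) +
  (- (H * h (x0 + k)))%:E)%E.
  congr (_ + _)%E; apply: eq_integral => x; rewrite inE/= in_itv/= => /andP[kx xk].
  by rewrite ramp_mid ?(ltW kx) ?(ltW xk)// -EFinM mulrA.
have hJ : mu.-integrable J (EFin \o h) by exact: (C1c_integrable mJ muJ hI).
rewrite integralZl//; last first.
  apply: (@continuous_itv_integrable _ (fun x => (x - (x0 - k)) * derive1 h x)).
  move=> x; apply: cvgM; last by case: hI => _ + _ _; exact.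
  by apply: cvgB; [exact: cvg_id|exact: cvg_cst].
rewrite (integral_affine_derive1_C1c hI kk).
have : (\int[mu]_(x in J) (h x)%:E)%E \is a fin_num by exact: integrable_fin_num.
rewrite /J; move: (\int[mu]_(x in _) (h x)%:E)%E => [r| |]// _.
apply: (congr1 EFin (_ : alpha * ((x0 + k - (x0 - k)) * h (x0 + k) - r)
  + - (H * h (x0 + k)) = - (alpha * r))).
have -> : H = 2 * alpha * k by rewrite -mulrA alphak; field.
by ring.
Qed.

Lemma ramp_jump_set : jump_set I u = set0.
Proof.
rewrite -subset0 => x; apply: jump_set_discontinuous; exact: ramp_continuous.
Qed.

Lemma ramp_BV : BV I u.
Proof.
split; first exact: ramp_integrable.
by exists ramp_charge; exact: ramp_distributional_derivative.
Qed.

Let slope x : R := alpha * \1_J x.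

Lemma ramp_decomposition :
  derivative_decomposition I u (DerivativeParts slope czero czero).
Proof.
have intA (A : set R) : measurable (A : set (measurableTypeR R)) ->
    mu.-integrable A (fun x => (\1_J x)%:E).
  by move=> mA; apply: (@integrableS _ _ _ mu setT) => //; exact: integrable_indic_itv.
split => //=.
- rewrite (_ : EFin \o slope = fun x => alpha%:E * (\1_J x)%:E)%E; last first.
    by apply/funext => x; rewrite /slope /= EFinM.
  by apply: integrableZl => //; exact: intA.
- exists set0; split => //; exact: measure0.
- by move=> x; rewrite ramp_jump_set.
- exists ramp_charge; first exact: ramp_distributional_derivative.
  move=> A mA AI; rewrite !adde0 /ramp_charge/slope.
  under eq_integral do rewrite EFinM.
  rewrite integralZl//; last exact: intA.
  rewrite integral_indic//.
  by rewrite /cscale/= /charge_of_finite_measure /mfrestr /mrestr/= setIC.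
Qed.

(** As [phi 0 = 0], only [J] contributes, and its length is [2 * k = H / alpha]. *)
Lemma ramp_nonlinear_TV phi theta : TV_integrands phi theta ->
  nonlinear_TV phi theta I u = (phi alpha / alpha * H)%:E.
Proof.
move=> pt.
(* The jump set is empty, so the choice of the point 0 is arbitrary. *)
have Ju : jump_set I u `<=` [set 0] by rewrite ramp_jump_set.
rewrite (nonlinear_TV_eq Ju pt ramp_decomposition) ramp_jump_set esum_set0 adde0.
transitivity (\int[mu]_(x in I) ((phi alpha)%:E * (\1_J x)%:E))%E.
  apply: eq_integral => x _; rewrite /slope indicE; case: (x \in J) => /=.
    by rewrite mulr1 mule1 gtr0_norm.
  by rewrite mulr0 mule0 normr0 (phi0 pt).
rewrite ge0_integralZl//.
- rewrite integral_indic// setIidl; last exact: ramp_support_sub.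
  have muJE : mu J = (2 * k)%:E.
    rewrite /J lebesgue_measure_itv/= lte_fin ifT; last by have := k_gt0; lra.
    by rewrite -EFinB; congr EFin; ring.
  transitivity ((phi alpha)%:E * (2 * k)%:E)%E; first by congr (_ * _)%E.
  rewrite -EFinM; congr EFin.
  have -> : H = 2 * alpha * k by rewrite -mulrA alphak; field.
  by field; rewrite gt_eqF.
- by apply/measurable_EFinP/measurable_funTS/measurable_indic.
- by rewrite lee_fin (phi_ge0 pt)// in_itv/= andbT ltW.
Qed.

End ramp.

(** * Comparison of norms, and norms of multiples of indicators *)

Section Lnorm_bounds.
Context d (T : measurableType d) (R : realType).
Variable mu : {measure set T -> \bar R}.
Implicit Types (f h : T -> R) (p : \bar R) (gamma c m : R) (E : set T).
Local Open Scope ereal_scope.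

(** For finite [p] the integrands compare almost everywhere and powers are monotone; for [p = +oo]
    the essential suprema compare. An almost-everywhere hypothesis leaves aside the unspecified
    value [g x0]. *)
Lemma ae_le_Lnorm p f h : 1 <= p -> measurable_fun setT f ->
    measurable_fun setT h -> {ae mu, forall x, (`|f x| <= `|h x|)%R} ->
  'N[mu]_p[EFin \o f] <= 'N[mu]_p[EFin \o h].
Proof.
move=> p1 mf mh fh; rewrite unlock; case: p p1 => [r||//] r1.
- have r0 : (0 <= r)%R by rewrite lee_fin in r1; rewrite (le_trans ler01).
  have mpow (u : T -> R) : measurable_fun setT u ->
      measurable_fun setT (fun x => `|(u x)%:E| `^ r).
    move=> mu0; apply: (measurableT_comp (measurable_poweR r)).
    by apply: measurableT_comp => //; exact/measurable_EFinP.
  have dom (x : \bar R) : 0 <= x -> x \in `[0, +oo].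
    by move=> x0; rewrite in_itv/= x0 leey.
  apply: gt0_ler_poweR.
  + by rewrite invr_ge0.
  + by apply: dom; apply: integral_ge0 => x _; exact: poweR_ge0.
  + by apply: dom; apply: integral_ge0 => x _; exact: poweR_ge0.
  apply: ae_ge0_le_integral => //; try by [move=> x _; exact: poweR_ge0|exact: mpow].
  apply: filterS fh => x fhx _.
  by apply: gt0_ler_poweR; rewrite ?dom ?lee_fin.
- by case: ifPn => // _; apply: le_ess_sup; apply: filterS fh => x /=; rewrite lee_fin.
Qed.

(** For finite [p = r] the integral is c^r m, and its power gamma / r splits. For [p = +oo] the
    essential supremum is [c], since [E] has positive mass, and the exponent of [m] is zero. *)
Lemma Lnorm_cst_indic p gamma c m E : 1 <= p -> measurable E ->
    mu E = m%:E -> (0 < m)%R -> (0 <= c)%R ->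
  'N[mu]_p[EFin \o (fun x => c * \1_E x)%R] `^ gamma =
  (c `^ gamma * m `^ div_exponent gamma p)%:E.
Proof.
move=> p1 mE mEm m0 c0; rewrite unlock; case: p p1 => [r||//] r1 /=.
- have r0 : (0 < r)%R by rewrite lee_fin in r1; rewrite (lt_le_trans ltr01).
  have -> : \int[mu]_x `|(c * \1_E x)%:E| `^ r = (c `^ r * m)%:E.
    transitivity (\int[mu]_x ((c `^ r)%:E * (\1_E x)%:E)).
      apply: eq_integral => x _; rewrite indicE; case: (x \in E) => /=.
        by rewrite mulr1 mule1 ger0_norm.
      by rewrite mulr0 mule0 normr0 powR0// gt_eqF.
    rewrite ge0_integralZl//; last 2 first.
    - by apply/measurable_EFinP; exact: measurable_indic.
    - by rewrite lee_fin powR_ge0.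
    by rewrite integral_indic// setIT mEm EFinM.
  rewrite !poweR_EFin; congr EFin.
  rewrite -powRrM powRM ?powR_ge0 ?ltW// -powRrM; congr (_ `^ _ * _ `^ _)%R.
    by field; rewrite gt_eqF.
  by rewrite mulrC.
(* Positive total mass makes the norm at infinity the essential supremum. *)
- have muT : 0 < mu [set: T].
    rewrite (@lt_le_trans _ _ (mu E))// ?mEm ?lte_fin//.
    by rewrite -mEm le_measure// inE.
  rewrite muT powRr0 mulr1; suff -> : ess_sup mu (abse \o (EFin \o (fun x => c * \1_E x)%R)) = c%:E.
    by rewrite poweR_EFin.
  apply/eqP; rewrite eq_le; apply/andP; split.
    apply/ess_supP; apply: nearW => x /=; rewrite lee_fin normrM ger0_norm//.
    by rewrite indicE; case: (x \in E); rewrite ?normr1 ?normr0 ?mulr1 ?mulr0.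
  apply: le_ereal_inf_tmp => y hy /=.
  (* An essential upper bound [y < c] would put [E] inside a null set. *)
  rewrite leNgt; apply/negP => yc.
  have [N [mN N0 EN]] := hy.
  have : mu E <= mu N.
    apply: le_measure; rewrite ?inE// => x Ex; apply: EN => /=.
    by rewrite indicE mem_set// mulr1 ger0_norm//; apply/negP; rewrite -ltNge.
  by rewrite N0 mEm lee_fin leNgt m0.
Qed.

End Lnorm_bounds.

(** * Two-sided bounds on the distance from the ramp to the step *)

Section distance_to_input.
Context {R : realType}.
Variables (L H x0 : R) (g : R -> R).
Hypotheses (H_gt0 : 0 < H) (x0_in : 0 < x0 < L).
Hypothesis g_left : forall x, 0 < x < x0 -> g x = 0.
Hypothesis g_right : forall x, x0 < x < L -> g x = H.
Let I : set R := `]0, L[%classic.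
Local Notation mu := (@lebesgue_measure R).

(** The bound on [alpha] says that the half-width [H / (2 * alpha)] does not exceed the distance
    from [x0] to either end of the domain. *)
Lemma ramp_half_width (alpha : R) :
    H / (2 * Num.min x0 (L - x0)) <= alpha ->
  exists k, [/\ 0 < alpha, alpha * k = H / 2, k <= x0 & x0 + k <= L].
Proof.
move=> alphaH; have /andP[x00 x0L] := x0_in.
have min0 : 0 < Num.min x0 (L - x0) by rewrite lt_min x00 subr_gt0.
have alpha0 : 0 < alpha by rewrite (lt_le_trans _ alphaH)// divr_gt0// mulr_gt0.
have kmin : H / (2 * alpha) <= Num.min x0 (L - x0).
  move: alphaH; rewrite !ler_pdivrMr ?mulr_gt0// => h.
  by rewrite mulrCA (mulrC _ alpha) mulrCA.
exists (H / (2 * alpha)); split => //.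
- by field; rewrite gt_eqF.
- by rewrite (le_trans kmin)// ge_min lexx.
- by rewrite addrC -lerBrDr (le_trans kmin)// ge_min lexx orbT.
Qed.

(** Both bounds come from [Lnorm_cst_indic], with constant [H / 2] on [J], of length [H / alpha],
    and constant [H / 4] on [E], of length [H / 4 / alpha]. *)
Lemma ramp_step_Lnorm (p : \bar R) (gamma alpha : R) :
    (1 <= p)%E -> 0 < gamma -> H / (2 * Num.min x0 (L - x0)) <= alpha ->
  let q := div_exponent gamma p in
  exists2 v : R,
    ('N[mu]_p[EFin \o ((ramp x0 H alpha \- g)%R \_ I)] `^ gamma = v%:E)%E &
    (H / 4) `^ gamma * (H / 4) `^ q * alpha `^ (- q) <= v
    <= (H / 2) `^ gamma * H `^ q * alpha `^ (- q).
Proof.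
move=> p1 gamma0 alphaH q.
have /andP[x00 x0L] := x0_in.
have [k [alpha0 alphak k_le k_ge]] := ramp_half_width alphaH.
have k0 : 0 < k by rewrite -(pmulr_rgt0 _ alpha0) alphak divr_gt0.
set J : set R := `]x0 - k, x0 + k[%classic.
(* On this interval [g] is zero and the ramp is at least [alpha * k / 2 = H / 4]. *)
set E : set R := `](x0 - k / 2), x0[%classic.
have muJ : mu J = (H / alpha)%:E.
  rewrite /J lebesgue_measure_itv/= lte_fin ifT; last by lra.
  rewrite -EFinB; congr EFin; have -> : H = 2 * alpha * k by rewrite -mulrA alphak; field.
  by field; rewrite gt_eqF.
have muE : mu E = (H / 4 / alpha)%:E.
  rewrite /E lebesgue_measure_itv/= lte_fin ifT; last by lra.
  rewrite -EFinB; congr EFin; have -> : H = 2 * alpha * k by rewrite -mulrA alphak; field.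
  by field; rewrite gt_eqF.
have mI : measurable (I : set (measurableTypeR R)) by exact: measurable_itv.
have md : measurable_fun [set: R] ((ramp x0 H alpha \- g)%R \_ I).
  apply/(measurable_restrictT _ mI)/measurable_funB.
    exact: ramp_measurable.
  exact: (step_measurable x0_in g_left g_right).
have mind (c : R) (A : set R) : measurable (A : set (measurableTypeR R)) ->
    measurable_fun [set: R] (fun x => c * \1_A x).
  by move=> mA; apply: measurable_funM => //; exact: measurable_indic.
have dom (x : \bar R) : (0 <= x -> x \in `[0, +oo])%E.
  by move=> ?; rewrite in_itv/= leey andbT.
have powN (c : R) : 0 <= c -> (c / alpha) `^ q = c `^ q * alpha `^ (- q).
  move=> c0; rewrite powRM ?invr_ge0 ?(ltW alpha0)//; congr (_ * _).
  by rewrite -powR_inv1 ?(ltW alpha0)// -powRrM mulN1r.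
have H2 : 0 < H / 2 by rewrite divr_gt0.
have H4 : 0 < H / 4 by rewrite divr_gt0.
have mJ : measurable (J : set (measurableTypeR R)) by exact: measurable_itv.
have mE : measurable (E : set (measurableTypeR R)) by exact: measurable_itv.
have mem_itv x : (x \in J) = (x0 - k < x < x0 + k).
  by rewrite /J mem_setE in_itv.
have up : ('N[mu]_p[EFin \o ((ramp x0 H alpha \- g)%R \_ I)] `^ gamma <=
    ((H / 2) `^ gamma * H `^ q * alpha `^ (- q))%:E)%E.
  rewrite -mulrA -(powN _ (ltW H_gt0)).
  rewrite -(Lnorm_cst_indic gamma p1 mJ muJ (divr_gt0 H_gt0 alpha0) (ltW H2)).
  apply: gt0_ler_poweR; [exact: ltW|exact/dom/Lnorm_ge0|exact/dom/Lnorm_ge0|].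
  apply: ae_le_Lnorm => //; first exact: mind.
  (* The value [g x0] is arbitrary, so [x0] is left to the exceptional null set. *)
  exists [set x0]; split; [exact: measurable_set1|exact: lebesgue_measure_set1|].
  move=> x; apply: contra_notP => /eqP xx0 /=; rewrite patchE.
  case: ifPn => [|_]; last by rewrite normr0.
  rewrite inE /I/= in_itv/= => /andP[x_gt0 xL].
  have ind0 : 0 <= H / 2 * \1_J x by apply: mulr_ge0 => //; exact: ltW.
  rewrite (ger0_norm ind0) indicE mem_itv.
  move: xx0; rewrite neq_lt => /orP[xx0|xx0].
    rewrite g_left ?x_gt0// subr0 ger0_norm ?ramp_ge0//.
    have [xk|kx] := leP x (x0 - k).
      by rewrite (ramp_le H_gt0 alpha0 alphak)// mulr_ge0 ?ler0n ?(ltW H2).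
    rewrite (ramp_mid alpha0 alphak) ?(ltW kx); last by lra.
    rewrite (_ : (x < x0 + k)); last by lra.
    by rewrite mulr1; nra.
  rewrite g_right ?xx0// distrC ger0_norm ?subr_ge0 ?ramp_le_height//.
  have [kx|xk] := leP (x0 + k) x.
    by rewrite (ramp_ge alpha0 alphak)// subrr mulr_ge0 ?ler0n ?(ltW H2).
  rewrite (ramp_mid alpha0 alphak) ?(ltW xk) ?andbT; last by lra.
  rewrite (_ : (x0 - k < x)); last by lra.
  by rewrite mulr1; nra.
have low : (((H / 4) `^ gamma * (H / 4) `^ q * alpha `^ (- q))%:E <=
    'N[mu]_p[EFin \o ((ramp x0 H alpha \- g)%R \_ I)] `^ gamma)%E.
  rewrite -mulrA -(powN _ (ltW H4)).
  rewrite -(Lnorm_cst_indic gamma p1 mE muE (divr_gt0 H4 alpha0) (ltW H4)).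
  apply: gt0_ler_poweR; [exact: ltW|exact/dom/Lnorm_ge0|exact/dom/Lnorm_ge0|].
  apply: ae_le_Lnorm => //; first exact: mind.
  apply: nearW => x; rewrite indicE; have [|] := boolP (x \in E); last first.
    by rewrite mulr0 normr0.
  rewrite inE /E/= in_itv/= mulr1 => /andP[kx xx0].
  have xI : x \in I by rewrite inE /I/= in_itv/=; apply/andP; split; lra.
  rewrite patchE xI /= g_left; last by apply/andP; split; lra.
  rewrite subr0 (ger0_norm (ltW H4)) ger0_norm ?ramp_ge0//.
  rewrite (ramp_mid alpha0 alphak); last by apply/andP; split; lra.
  by nra.
(* Squeezed between two real bounds, the extended real is a real number. *)
move: up low; case: (_ `^ _)%E => [v| |]//; rewrite !lee_fin => up low.
by exists v => //; rewrite low.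
Qed.

End distance_to_input.

(** * Comparison of the energies of the step and of the ramps *)

Lemma step_Lnorm0 (R : realType) (I : set R) (g : R -> R) (p : \bar R) (gamma : R) :
  (1 <= p)%E -> 0 < gamma ->
  ('N[@lebesgue_measure R]_p[EFin \o ((g \- g)%R \_ I)] `^ gamma = 0)%E.
Proof.
move=> p1 gamma0.
have -> : EFin \o ((g \- g)%R \_ I) = cst 0%E.
  by apply/funext => x /=; rewrite patchE/= subrr if_same.
(* The power of the zero norm vanishes because [gamma] is positive; exponent zero would give 1. *)
by rewrite Lnorm0 ?poweR0r ?gt_eqF// (lt_le_trans _ p1)// lte01.
Qed.

Theorem proposition4p10 (R : realType) (phi theta : R -> R)
    (phi_theta : TV_integrands phi theta)
    (L H x0 : R) (L_gt0 : 0 < L) (H_gt0 : 0 < H) (x0_in : 0 < x0 < L)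
    (p : \bar R) (p_ge1 : (1 <= p)%E) (gamma : R) (gamma_gt0 : 0 < gamma)
    (g : R -> R)
    (g_left : forall x, 0 < x < x0 -> g x = 0)
    (g_right : forall x, x0 < x < L -> g x = H) :
  let I : set R := `]0, L[%classic in
  let F := denoising_functional phi theta I g p gamma in
  let alpha_star : R := H / (2 * Num.min x0 (L - x0)) in
  let inf_quotient : \bar R :=
    ereal_inf [set (slope_quotient phi gamma p alpha)%:E
              | alpha in [set alpha | alpha_star <= alpha]] in
  [/\ BV I g,
      forall alpha, alpha_star <= alpha -> BV I (ramp x0 H alpha),
      theta H = H -> inf_quotient = -oo%E ->
        forall lambda, 0 <= lambda ->
          (exists2 alpha, alpha_star <= alpha &
            (F lambda (ramp x0 H alpha) < F lambda g)%E) /\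
          ~ (forall u, BV I u -> (F lambda g <= F lambda u)%E) &
      theta H < H \/ (theta H = H /\ (-oo < inf_quotient)%E) ->
        exists2 lambda0, 0 <= lambda0 &
          forall lambda, lambda0 <= lambda ->
            forall alpha, alpha_star <= alpha ->
              (F lambda g <= F lambda (ramp x0 H alpha))%E].
Proof.
move=> I F alpha_star inf_quotient.
have /andP[x00 x0L] := x0_in.
have min0 : 0 < Num.min x0 (L - x0) by rewrite lt_min x00 subr_gt0.
have star0 : 0 < alpha_star by rewrite divr_gt0// mulr_gt0.
have gBV : BV I g by exact: (step_BV H_gt0 x0_in g_left g_right).
set q := div_exponent gamma p.
have q0 : 0 <= q.
  rewrite /q; move: p_ge1; case: (p) => [r||]//; rewrite lee_fin => r1.
  by rewrite divr_ge0 ?(ltW gamma_gt0)// (le_trans ler01).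
have hk := ramp_half_width H_gt0 x0_in.
have uBV alpha : alpha_star <= alpha -> BV I (ramp x0 H alpha).
  by move=> /hk[k [a0 ak k1 k2]]; exact: (ramp_BV H_gt0 a0 ak k1 k2).
have Fg lambda : F lambda g = (theta H)%:E.
  by rewrite /F /denoising_functional step_Lnorm0// mule0 adde0
    (step_nonlinear_TV H_gt0 x0_in g_left g_right phi_theta).
pose C1 := (H / 2) `^ gamma * H `^ q.
pose C2 := (H / 4) `^ gamma * (H / 4) `^ q.
have C2_gt0 : 0 < C2 by rewrite mulr_gt0 ?powR_gt0 ?divr_gt0.
have Fu lambda alpha : alpha_star <= alpha -> exists2 v,
    F lambda (ramp x0 H alpha) = (phi alpha / alpha * H + lambda * v)%:E &
    C2 * alpha `^ (- q) <= v <= C1 * alpha `^ (- q).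
  move=> aa; have [k [a0 ak k1 k2]] := hk _ aa.
  have [v Nv Cv] := ramp_step_Lnorm H_gt0 x0_in g_left g_right p_ge1 gamma_gt0 aa.
  exists v => //; rewrite /F /denoising_functional Nv.
  by rewrite (ramp_nonlinear_TV H_gt0 a0 ak k1 k2 phi_theta) -EFinM -EFinD.
have slopeE alpha : alpha_star <= alpha ->
    phi alpha / alpha = 1 + slope_quotient phi gamma p alpha * alpha `^ (- q).
  move=> aa; have a0 : 0 < alpha by rewrite (lt_le_trans star0).
  have P0 : 0 < alpha `^ (- q) by exact: powR_gt0.
  rewrite /slope_quotient -/q powRD; last by rewrite (gt_eqF a0) implybT.
  rewrite powRr1 ?(ltW a0)//. by field; rewrite (gt_eqF a0) (gt_eqF P0).
split => //.
- move=> thetaH infNy lambda lambda0.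
  have [alpha aa Fa] : exists2 alpha, alpha_star <= alpha &
      (F lambda (ramp x0 H alpha) < F lambda g)%E.
    (* Below this threshold the drop in total variation, [H] times the absolute value of the
       quotient times alpha^(-q), exceeds the upper bound [lambda * C1] times alpha^(-q) on the
       fidelity term. *)
    have : (inf_quotient < (- (lambda * C1 / H))%:E)%E by rewrite infNy ltNyr.
    move=> /ereal_inf_lt[_ [alpha /= aa <-]]; rewrite lte_fin => sq.
    exists alpha => //; have [v -> /andP[_ vC1]] := Fu lambda alpha aa.
    rewrite Fg thetaH lte_fin slopeE//.
    have a0 : 0 < alpha by rewrite (lt_le_trans star0).
    have P0 : 0 < alpha `^ (- q) by exact: powR_gt0.
    have h1 : lambda * v <= lambda * (C1 * alpha `^ (- q)) by rewrite ler_wpM2l.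
    have h2 : slope_quotient phi gamma p alpha * alpha `^ (- q) * H <
        - (lambda * C1 / H) * alpha `^ (- q) * H by rewrite ltr_pM2r// ltr_pM2r.
    have h3 : - (lambda * C1 / H) * alpha `^ (- q) * H = - (lambda * (C1 * alpha `^ (- q))).
      by field; rewrite gt_eqF.
    by rewrite mulrDl mul1r; lra.
  split; first by exists alpha.
  by move=> /(_ _ (uBV _ aa)); rewrite leNgt Fa.
- case=> [thetaH|[thetaH infgt]].
    (* Since [theta H / H < 1], the total variation of the ramp alone exceeds [theta H] for all
       [alpha] above some [A]. *)
    have /(cvgr_gt 1) : phi t / t @[t --> +oo] --> (1 : R) by exact: (phi_slope phi_theta).
    move=> /(_ (theta H / H)); rewrite ltr_pdivrMr ?mul1r// => /(_ thetaH).
    move=> [A [_ hA]].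
    (* A positive bound for the remaining [alpha <= A]. As [q >= 0], alpha^(-q) is at least B^(-q)
       there, and the threshold on [lambda] makes the fidelity term alone reach [theta H]. *)
    pose B := Num.max A 1.
    have B0 : 0 < B by rewrite lt_max ltr01 orbT.
    have PB0 : 0 < B `^ (- q) by exact: powR_gt0.
    have thH0 : 0 <= theta H by rewrite (theta_ge0 phi_theta)// in_itv/= andbT ltW.
    exists (theta H / (C2 * B `^ (- q))) => [|lambda lambda0 alpha aa].
      by rewrite divr_ge0// ltW// mulr_gt0.
    have a0 : 0 < alpha by rewrite (lt_le_trans star0).
    have P0 : 0 < alpha `^ (- q) by exact: powR_gt0.
    have l0 : 0 <= lambda.
      by rewrite (le_trans _ lambda0)// divr_ge0// ltW// mulr_gt0.
    have [v -> /andP[vC2 _]] := Fu lambda alpha aa.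
    rewrite Fg lee_fin.
    have v0 : 0 <= v by rewrite (le_trans _ vC2)// ltW// mulr_gt0.
    have [Aa|aA] := ltP A alpha.
      have := hA _ Aa; rewrite /= ltr_pdivrMr// => h.
      by rewrite (le_trans (ltW h))// lerDl mulr_ge0.
    have pB : B `^ (- q) <= alpha `^ (- q).
      rewrite !powRN lef_pV2 ?posrE ?powR_gt0//.
      by rewrite ge0_ler_powR ?nnegrE ?(ltW a0) ?(ltW B0)// le_max aA.
    have phi0 : 0 <= phi alpha / alpha * H.
      rewrite mulr_ge0 ?(ltW H_gt0)// divr_ge0 ?(ltW a0)//.
      by rewrite (phi_ge0 phi_theta)// in_itv/= andbT ltW.
    have : theta H <= lambda * v.
      move: lambda0; rewrite ler_pdivrMr ?(mulr_gt0 C2_gt0 PB0)// => /le_trans; apply.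
      rewrite ler_wpM2l// (le_trans _ vC2)// ler_pM2l//.
    lra.
  have [M hM] : exists M, forall alpha, alpha_star <= alpha -> M <= slope_quotient phi gamma p alpha.
    (* The infimum is a real number: it is not -oo by hypothesis, and it lies below the real value
       of the quotient at [alpha]. *)
    exists (fine inf_quotient) => alpha aa.
    have : (inf_quotient <= (slope_quotient phi gamma p alpha)%:E)%E.
      by apply: ereal_inf_lbound; exists alpha.
    by move: infgt; case: inf_quotient => [r| |]//=; rewrite lee_fin.
  (* With this threshold the lower bound [lambda * C2] times alpha^(-q) on the fidelity term absorbs
     the largest possible deficit in total variation, |M| H alpha^(-q); the absolute value keeps the
     threshold nonnegative. *)
  exists (`|M| * H / C2) => [|lambda lambda0 alpha aa].
    by rewrite divr_ge0 ?(ltW C2_gt0)// mulr_ge0// ltW.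
  have a0 : 0 < alpha by rewrite (lt_le_trans star0).
  have P0 : 0 < alpha `^ (- q) by exact: powR_gt0.
  have l0 : 0 <= lambda by rewrite (le_trans _ lambda0)// divr_ge0 ?(ltW C2_gt0)// mulr_ge0// ltW.
  have [v -> /andP[vC2 _]] := Fu lambda alpha aa.
  rewrite Fg lee_fin thetaH slopeE// mulrDl mul1r -addrA lerDl.
  have h1 : lambda * (C2 * alpha `^ (- q)) <= lambda * v by rewrite ler_wpM2l.
  have h2 : `|M| * H * alpha `^ (- q) <= lambda * (C2 * alpha `^ (- q)).
    by rewrite mulrA ler_pM2r// -ler_pdivrMr.
  have h3 : - `|M| * alpha `^ (- q) * H <= slope_quotient phi gamma p alpha * alpha `^ (- q) * H.
    rewrite ler_pM2r// ler_pM2r// (le_trans _ (hM _ aa))// lerNl -normrN.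
    exact: ler_norm.
  lra.
Qed.
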